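(* Let $\mathbf{p}\in[0,1]^n$, let $\mathcal{X}\subseteq\{0,1\}^n$ be the (nonempty) set of feasible solutions, and let $$\mathrm{OPT}=\min_{\mathbf{x}\in\mathcal{X}} f(\mathbf{x}),\qquad f(\mathbf{x})=\max_{\theta\in\Theta(\mathbf{p},p_ip_j;(i,j)\in K_n)}\mathbb{E}_\theta\left[\max_{i\in[n]}\tilde c_ix_i\right],$$ be the optimal value of the distributionally robust bottleneck combinatorial optimization problem. Suppose linear functions can be optimized over the set $\mathcal{X}$ in polynomial time. Then one can find $\hat{\mathbf{x}}\in\mathcal{X}$ in polynomial time such that $$\mathrm{OPT}\le f(\hat{\mathbf{x}})\le\frac{4}{3}\,\mathrm{OPT}.$$
   Context: Write $[n]=\{1,\ldots,n\}$ and $K_n=\{(i,j): 1\le i<j\le n\}$. For $\mathbf{p}=(p_1,\ldots,p_n)\in[0,1]^n$, $\Theta(\mathbf{p},p_ip_j;(i,j)\in K_n)$ is the set of all probability distributions $\theta$ on $\{0,1\}^n$ of a random vector $\tilde{\mathbf{c}}=(\tilde c_1,\ldots,\tilde c_n)$ such that $\mathbb{P}_\theta(\tilde c_i=1)=p_i$ for all $i\in[n]$ and $\mathbb{P}_\theta(\tilde c_i=1,\tilde c_j=1)=p_ip_j$ for all $(i,j)\in K_n$ (pairwise independent Bernoulli costs). The decision vector is $\mathbf{x}=(x_1,\ldots,x_n)\in\mathcal{X}$, where $x_i=1$ means element $i$ is selected; $\max_{i}\tilde c_ix_i$ is the bottleneck cost. *)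

(* Defs.v *)
From HB Require Import structures.
From mathcomp Require Import all_boot all_order all_algebra.
From mathcomp Require Import all_classical all_reals all_analysis.
Set Implicit Arguments.
Unset Strict Implicit.
Unset Printing Implicit Defensive.
Import Order.TTheory GRing.Theory Num.Theory.
Import numFieldNormedType.Exports.
Local Open Scope classical_set_scope.
Local Open Scope ring_scope.

Definition vec01 (n : nat) := {ffun 'I_n -> bool}.

Section Robust.
Variables (R : realType) (n : nat).

Definition prob (th : {ffun vec01 n -> R}) (E : pred (vec01 n)) : R :=
  \sum_(c | E c) th c.

Definition expect (th : {ffun vec01 n -> R}) (g : vec01 n -> R) : R :=
  \sum_c th c * g c.

Definition is_distr (th : {ffun vec01 n -> R}) : Prop :=
  (forall c, 0 <= th c) /\ \sum_c th c = 1.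

Definition Theta (p : 'I_n -> R) : set {ffun vec01 n -> R} :=
  [set th | [/\ is_distr th,
    forall i, prob th (fun c => c i) = p i
  & forall i j : 'I_n, (i < j)%N ->
      prob th (fun c => c i && c j) = p i * p j]].

(* The maximum over an empty index set (n = 0) is 0. *)
Definition bottleneck (x c : vec01 n) : nat := (\max_(i < n) (c i * x i))%N.

(* The supremum is a maximum: see [worst_case_attained]. *)
Definition worst_case (p : 'I_n -> R) (x : vec01 n) : R :=
  sup [set expect th (fun c => (bottleneck x c)%:R) | th in Theta p].

(* For nonempty X the infimum is a minimum: see [opt_attained]. *)
Definition opt (p : 'I_n -> R) (X : {set vec01 n}) : R :=
  inf [set worst_case p x | x in [set` X]].

Definition lin_cost (c : 'I_n -> R) (x : vec01 n) : R :=
  \sum_i c i * (x i)%:R.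

End Robust.

Section Attainment.
Variables (R : realType) (n : nat).
Implicit Types (p : 'I_n -> R) (x : vec01 n) (X : {set vec01 n}).

Definition indep (p : 'I_n -> R) : {ffun vec01 n -> R} :=
  [ffun c : vec01 n => \prod_i (if c i then p i else 1 - p i)].

Lemma indep_marginal p (A : {set 'I_n}) :
  \sum_(c : vec01 n | [forall i in A, c i]) indep p c = \prod_(i in A) p i.
Proof.
pose P i := [pred b : bool | (i \in A) ==> b].
transitivity (\prod_(i < n) \sum_(b | P i b) (if b then p i else 1 - p i)).
  rewrite bigA_distr_big_dep /=; apply: eq_big => [c|c _]; last by rewrite ffunE.
  exact/forallP/familyP.
rewrite [RHS]big_mkcond /=; apply: eq_bigr => i _.
rewrite big_mkcond big_bool /= /P /=; case: (i \in A) => /=.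
  by rewrite addr0.
by rewrite addrC subrK.
Qed.

Lemma indep_Theta p : (forall i, 0 <= p i <= 1) -> Theta p (indep p).
Proof.
move=> hp; split.
- split=> [c|].
    rewrite ffunE; apply: prodr_ge0 => i _; have /andP[h0 h1] := hp i.
    by case: ifP => // _; rewrite subr_ge0.
  rewrite -[RHS](_ : \prod_(i in finset.set0) p i = 1); last by rewrite big_set0.
  rewrite -indep_marginal; apply: eq_bigl => c.
  by apply/esym/forallP => i; rewrite inE.
- move=> i; rewrite -[RHS](_ : \prod_(j in [set i]%SET) p j = p i); last by rewrite big_set1.
  rewrite -indep_marginal; apply: eq_bigl => c.
  apply/idP/forallP => [ci j|/(_ i)]; last by rewrite inE eqxx.
  by apply/implyP; rewrite inE => /eqP ->.
- move=> i j ij; have nij : i != j by rewrite -val_eqE /= neq_ltn ij.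
  rewrite -[RHS](_ : \prod_(k in [set i; j]%SET) p k = p i * p j); last first.
    by rewrite big_setU1 ?inE //= big_set1.
  rewrite -indep_marginal; apply: eq_bigl => c.
  apply/andP/forallP => [[ci cj] k|h].
    by apply/implyP; rewrite !inE => /orP[] /eqP ->.
  by have := h i; have := h j; rewrite !inE !eqxx orbT.
Qed.

Lemma worst_case_attained p x : (forall i, 0 <= p i <= 1) ->
  exists2 th, Theta p th &
    worst_case p x = expect th (fun c => (bottleneck x c)%:R) /\
    forall th', Theta p th' ->
      expect th' (fun c => (bottleneck x c)%:R) <= worst_case p x.
Proof.
move=> hp; pose N := #|{: vec01 n}|.
pose tof (v : 'rV[R]_N) : {ffun vec01 n -> R} := [ffun c => v ord0 (enum_rank c)].
pose tov (th : {ffun vec01 n -> R}) : 'rV[R]_N := \row_j th (enum_val j).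
have tovK th : tof (tov th) = th.
  by apply/ffunP => c; rewrite ffunE mxE enum_rankK.
pose g c : R := (bottleneck x c)%:R.
pose F v := expect (tof v) g.
have tofC c : continuous (fun v => tof v c).
  move=> v; rewrite /continuous_at ffunE; under eq_fun do rewrite ffunE.
  exact: coord_continuous.
have sumC (E : pred (vec01 n)) (h : vec01 n -> R) :
    continuous (fun v : 'rV[R]_N => \sum_(c | E c) tof v c * h c).
  move=> v; rewrite /continuous_at.
  have := @cvg_big R _ +%R 0 E (@add_continuous R) _ (nbhs v)
    (index_enum _) (fun c u => tof u c * h c) (fun c => tof v c * h c) _.
  apply=> c _; apply: cvgMr_tmp; exact: tofC.
have probC E : continuous (fun v => prob (tof v) E).
  rewrite (_ : (fun v => _) = (fun v => \sum_(c | E c) tof v c * 1)); first exact: sumC.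
  by apply/funext => v; apply: eq_bigr => c _; rewrite mulr1.
have cl1 (G : 'rV[R]_N -> R) (a : R) : continuous G -> closed [set v | G v = a].
  move=> cG; apply: (@closed_comp _ _ G [set a]) => [v _|]; [exact: cG|exact: closed_eq].
pose A := [set v | Theta p (tof v)].
have AE : A = (\bigcap_c [set v | 0 <= tof v c]) `&` [set v | prob (tof v) xpredT = 1]
   `&` (\bigcap_i [set v | prob (tof v) (fun c => c i) = p i])
   `&` (\bigcap_(ij in [set ij : 'I_n * 'I_n | (ij.1 < ij.2)%N])
         [set v | prob (tof v) (fun c => c ij.1 && c ij.2) = p ij.1 * p ij.2]).
  apply/seteqP; split=> [v [[h0 h1] h2 h3]|v [[[h0 h1] h2] h3]].
    by split; [split; [split=> // c _; exact: h0|move=> i _; exact: h2]|move=> [i j] ij; exact: h3].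
  split; [split=> // c; exact: h0|move=> i; exact: h2|].
  by move=> i j ij; exact: (h3 (i, j)).
have clA : closed A.
  rewrite AE; apply: closedI; first apply: closedI; first apply: closedI.
  - apply: closed_bigI => c _.
    apply: (@closed_comp _ _ (fun v => tof v c) [set y | 0 <= y]); last exact: closed_ge.
    by move=> v _; exact: tofC.
  - exact: cl1.
  - by apply: closed_bigI => i _; exact: cl1.
  - by apply: closed_bigI => ij _; exact: cl1.
have bA : bounded_set A.
  exists 1; split=> // M M1 v [[h0 h1] _ _] /=.
  apply/(le_trans _ (ltW M1)); rewrite /Num.norm /= mx_normrE; apply: bigmax_le => // -[i j] _ /=.
  rewrite (ord1 i).
  have -> : v ord0 j = tof v (enum_val j) by rewrite ffunE enum_valK.
  rewrite ger0_norm // -h1 (bigD1 (enum_val j)) //= lerDl; exact: sumr_ge0.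
have cA : compact A by exact: bounded_closed_compact.
have A0 : A !=set0 by exists (tov (indep p)); rewrite /A /= tovK; exact: indep_Theta.
have [|v /set_mem Av vmax] := @EVT_max_rV R N F A A0 cA.
  by apply: continuous_subspaceT => v; exact: sumC.
exists (tof v) => //.
have ub th' : Theta p th' -> expect th' g <= F v.
  by move=> h; rewrite -(tovK th'); apply: vmax; rewrite inE /A /= tovK.
have -> : worst_case p x = F v; last by split.
apply/eqP; rewrite eq_le; apply/andP; split.
  apply: ge_sup; first by exists (F v); exists (tof v).
  by move=> _ [th' h <-]; exact: ub.
apply: ub_le_sup; last by exists (tof v).
by exists (F v) => _ [th' h <-]; exact: ub.
Qed.

Lemma opt_attained p X : X != finset.set0 ->
  exists2 x, x \in X & opt p X = worst_case p x /\
    forall y, y \in X -> opt p X <= worst_case p y.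
Proof.
case/set0Pn => x0 x0X.
have [x xX xmin] := arg_minP (worst_case p) x0X.
exists x => //.
have -> : opt p X = worst_case p x; last by split.
apply/eqP; rewrite eq_le; apply/andP; split.
  apply: ge_inf; last by exists x.
  by exists (worst_case p x) => _ [y yX <-]; exact: xmin.
apply: lb_le_inf; first by exists (worst_case p x); exists x.
by move=> _ [y yX <-]; exact: xmin.
Qed.

End Attainment.

(* A machine-independent programming language in the style of Jones' WHILE
    language, acting on binary trees whose leaves may carry numbers.  Two cost
    models are provided:
    - [BitCost]: numbers are rationals in lowest terms, and arithmetic is charged
      the bit lengths of its operands (logarithmic cost); this is polynomially
      equivalent to Turing machines.
    - [UnitCost]: numbers are arbitrary reals, and arithmetic has cost 1
      (real RAM).
    The only constants of the language are 0 and 1. *)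

Inductive cost_model := BitCost | UnitCost.

Section Computation.
Variable R : realType.

Definition admissible (m : cost_model) : set R :=
  match m with BitCost => range (@ratr R) | UnitCost => setT end.

Definition bitlen (k : nat) : nat := (trunc_log 2 k).+1.

(* Under [BitCost] only rational numbers occur, as they are closed under the
   arithmetic operations; the value on irrational numbers is irrelevant. *)
Definition num_size (m : cost_model) (r : R) : nat :=
  match m with
  | BitCost => let q := xget 0 [set q : rat | ratr q = r] in
               (bitlen `|numq q| + bitlen `|denq q|)%N
  | UnitCost => 1
  end.

Inductive data := DNil | DNum of R | DPair of data & data.

Fixpoint data_size (m : cost_model) (d : data) : nat :=
  match d with
  | DNil => 1
  | DNum r => (num_size m r).+1
  | DPair a b => (data_size m a + data_size m b).+1
  end.

Definition data_seq (s : seq R) : data :=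
  foldr (fun r d => DPair (DNum r) d) DNil s.

Definition data_bits (s : seq bool) : data :=
  data_seq [seq (nat_of_bool b)%:R | b <- s].

Definition data_vec (n : nat) (v : 'I_n -> R) : data :=
  data_seq [seq v i | i <- enum 'I_n].

Definition data_vec01 (n : nat) (x : vec01 n) : data :=
  data_vec (fun i => (x i)%:R).

Inductive arith_op := OpAdd | OpSub | OpMul | OpDiv | OpLe.

Definition arith_val (o : arith_op) (a b : R) : data :=
  match o with
  | OpAdd => DNum (a + b)
  | OpSub => DNum (a - b)
  | OpMul => DNum (a * b)
  | OpDiv => DNum (a / b)
  | OpLe => if a <= b then DNum 1 else DNil
  end.

Inductive prog :=
| PId | PNil | PZero | POne
| PFst | PSnd | PIsNum
| PArith of arith_op
| PPair of prog & prog
| PComp of prog & prog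
| PIf of prog & prog & prog
| PWhile of prog & prog.

Definition dfst (d : data) := if d is DPair a _ then a else DNil.
Definition dsnd (d : data) := if d is DPair _ b then b else DNil.
Definition disnum (d : data) := if d is DNum _ then DNum 1 else DNil.
Definition dtrue (d : data) := if d is DNil then false else true.

Definition darith (o : arith_op) (d : data) : data :=
  if d is DPair (DNum a) (DNum b) then arith_val o a b else DNil.

Definition darith_cost (m : cost_model) (d : data) : nat :=
  if d is DPair (DNum a) (DNum b) then (num_size m a + num_size m b)%N else 0.

(* [run m P d e t]: on input [d], program [P] halts with output [e] at cost [t].
   [PComp f g] runs [f] first. *)
Inductive run (m : cost_model) : prog -> data -> data -> nat -> Prop :=
| run_id d : run m PId d d 1
| run_nil d : run m PNil d DNil 1
| run_zero d : run m PZero d (DNum 0) 1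
| run_one d : run m POne d (DNum 1) 1
| run_fst d : run m PFst d (dfst d) 1
| run_snd d : run m PSnd d (dsnd d) 1
| run_isnum d : run m PIsNum d (disnum d) 1
| run_arith o d : run m (PArith o) d (darith o d) (darith_cost m d).+1
| run_pair f g d a b s t : run m f d a s -> run m g d b t ->
    run m (PPair f g) d (DPair a b) (s + t).+1
| run_comp f g d a b s t : run m f d a s -> run m g a b t ->
    run m (PComp f g) d b (s + t).+1
| run_if c f g d a b s t : run m c d a s ->
    run m (if dtrue a then f else g) d b t ->
    run m (PIf c f g) d b (s + t).+1
| run_while_stop c f d a s : run m c d a s -> ~~ dtrue a ->
    run m (PWhile c f) d d s.+1
| run_while_step c f d a e b s t u : run m c d a s -> dtrue a ->
    run m f d e t -> run m (PWhile c f) e b u ->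
    run m (PWhile c f) d b (s + t + u).+1.

Lemma run_det m P d e t : run m P d e t ->
  forall e' t', run m P d e' t' -> e = e' /\ t = t'.
Proof.
elim=> {P d e t}.
1-8: by move=> *; match goal with H : run _ _ _ _ _ |- _ => inversion H end.
all: intros; match goal with H : run _ _ _ _ _ |- _ => inversion H end; subst.
all: repeat match goal with
  | IH : forall e t, run _ ?P ?d e t -> _, H : run _ ?P ?d _ _ |- _ =>
      case: (IH _ _ H) => ? ?; clear H; subst
  end; first [by split | by exfalso; repeat match goal with
  | H : is_true (~~ _) |- _ => move/negP: H => H end; auto].
Qed.

(* Since [data_size m d >= 1], these bounds dominate every polynomial in the
   input size as k grows. *)
Definition computes_within (m : cost_model) (P : prog) (k : nat) (d e : data) :=
  exists2 t, run m P d e t & (t <= k * data_size m d ^ k)%N.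

End Computation.

Arguments admissible {R} m.
Arguments DNil {R}.

(* Main.v *)
Require Import Defs.
From HB Require Import structures.
From mathcomp Require Import all_boot all_order all_algebra.
From mathcomp Require Import all_classical all_reals all_analysis.
From mathcomp Require Import ring lra.
Set Implicit Arguments.
Unset Strict Implicit.
Unset Printing Implicit Defensive.
Import Order.TTheory GRing.Theory Num.Theory.
Local Open Scope ring_scope.

(** Minimizing the linear function [lin_cost p] over the feasible set already
    gives a 4/3-approximation, so the linear optimization program itself, run
    on the cost vector [p], is the required algorithm.  The reason is the
    two-sided estimate
      [3/4 * min 1 (lin_cost p x) <= worst_case p x <= min 1 (lin_cost p x)],
    whose outer terms are nondecreasing in [lin_cost p x]: if [x] minimizes
    [lin_cost p] and [y] is optimal, then [worst_case p x] is at most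
    [min 1 (lin_cost p x) <= min 1 (lin_cost p y) <= 4/3 * worst_case p y].

    The upper bound ([worst_case_le]) is the union bound.  The lower bound
    ([worst_case_ge]) needs a pairwise independent distribution under which
    the selected events rarely overlap.  Suppose first that the marginals [a]
    have sum [S <= 1], and let [m] be the largest of them.  With probability
    [m ^+ 2] draw independent bits of means [a i / m]; with probability
    [(1 - m) * a k] set exactly the bit [k]; otherwise set no bit.  The means
    are [m * a i + (1 - m) * a i = a i], the pair probabilities are
    [m ^+ 2 * (a i / m) * (a j / m) = a i * a j], and some bit is set with
    probability [m ^+ 2 + (1 - m) * S >= S - S ^+ 2 / 4 >= 3/4 * S].
    For arbitrary marginals [p] and selection [x], this is applied to the
    vector [a i = s * (p i * x i)], with [s] scaling the sum down to
    [min 1 (lin_cost p x)]; taking the disjunction of each bit with a further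
    independent bit then raises the marginals from [a] to [p], which keeps
    pairwise independence and only enlarges the union. *)

(** * Mixtures of product distributions *)

Section Mixtures.
Variables (R : realType) (n : nat) (T : finType).
Implicit Types (w : T -> R) (q : T -> 'I_n -> R) (p r : 'I_n -> R).

(** The mixture, with weights [w], of the product distributions whose
    marginals are [q t]. *)
Definition mixture w q : {ffun vec01 n -> R} :=
  [ffun c => \sum_t w t * indep (q t) c].

Lemma prob_mixture w q E :
  prob (mixture w q) E = \sum_t w t * prob (indep (q t)) E.
Proof.
rewrite /prob; under eq_bigr do rewrite ffunE.
by rewrite exchange_big /=; apply: eq_bigr => t _; rewrite mulr_sumr.
Qed.

Lemma expect_mixture w q g :
  expect (mixture w q) g = \sum_t w t * expect (indep (q t)) g.
Proof.
rewrite /expect; under eq_bigr do rewrite ffunE mulr_suml.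
rewrite exchange_big /=; apply: eq_bigr => t _.
by rewrite mulr_sumr; apply: eq_bigr => c _; rewrite mulrA.
Qed.

(** The bits of a mixture of product distributions are pairwise independent
    as soon as their conditional means are pairwise uncorrelated. *)
Lemma mixture_Theta w q p :
  (forall t, 0 <= w t) -> \sum_t w t = 1 ->
  (forall t i, 0 <= q t i <= 1) ->
  (forall i, \sum_t w t * q t i = p i) ->
  (forall i j, i != j -> \sum_t w t * (q t i * q t j) = p i * p j) ->
  Theta p (mixture w q).
Proof.
move=> w0 w1 q01 qp qpp; split.
- split=> [c|].
    rewrite ffunE sumr_ge0 // => t _; rewrite mulr_ge0 //.
    by have [[h _] _ _] := indep_Theta (q01 t).
  rewrite -[LHS]/(prob (mixture w q) xpredT) prob_mixture -[RHS]w1.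
  apply: eq_bigr => t _; have [[_ h] _ _] := indep_Theta (q01 t).
  by rewrite /prob h mulr1.
- move=> i; rewrite prob_mixture -qp; apply: eq_bigr => t _.
  by have [_ -> _] := indep_Theta (q01 t).
- move=> i j ij; rewrite prob_mixture -qpp; last first.
    by rewrite -val_eqE /= neq_ltn ij.
  by apply: eq_bigr => t _; have [_ _ ->] := indep_Theta (q01 t).
Qed.

(** Disjunction of every bit with an independent bit of mean [r i]: the
    conditional means [q t i] become [r i + (1 - r i) * q t i]. *)
Lemma mixture_or_Theta w q p r :
  (forall t, 0 <= w t) -> \sum_t w t = 1 ->
  (forall t i, 0 <= q t i <= 1) -> (forall i, 0 <= r i <= 1) ->
  (forall i, \sum_t w t * q t i = p i) ->
  (forall i j, i != j -> \sum_t w t * (q t i * q t j) = p i * p j) ->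
  Theta (fun i => r i + (1 - r i) * p i)
        (mixture w (fun t i => r i + (1 - r i) * q t i)).
Proof.
move=> w0 w1 q01 r01 qp qpp; apply: mixture_Theta => //.
- by move=> t i; have /andP[? ?] := q01 t i; have /andP[? ?] := r01 i; nra.
- move=> i; transitivity (r i * \sum_t w t + (1 - r i) * \sum_t w t * q t i).
    by rewrite !mulr_sumr -big_split; apply: eq_bigr => t _ /=; ring.
  by rewrite w1 qp mulr1.
- move=> i j ij.
  transitivity (r i * r j * \sum_t w t
      + r i * (1 - r j) * \sum_t w t * q t j
      + (1 - r i) * r j * \sum_t w t * q t i
      + (1 - r i) * (1 - r j) * \sum_t w t * (q t i * q t j)).
    rewrite !mulr_sumr -!big_split; apply: eq_bigr => t _ /=; ring.
  by rewrite w1 !qp qpp //; ring.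
Qed.

End Mixtures.

(** * Bounds on the worst-case expected bottleneck *)

Section Bounds.
Variables (R : realType) (n : nat).
Implicit Types (p : 'I_n -> R) (x c : vec01 n).

Lemma bottleneck_le1 x c : (bottleneck x c <= 1)%N.
Proof. by apply/bigmax_leqP => i _; case: (c i); case: (x i). Qed.

Lemma bottleneck_le_sum x c : (bottleneck x c <= \sum_i c i * x i)%N.
Proof. by apply/bigmax_leqP => i _; rewrite (bigD1 i) //= leq_addr. Qed.

Lemma expect_bottleneck_ge0 (th : {ffun vec01 n -> R}) x :
  (forall c, 0 <= th c) -> 0 <= expect th (fun c => (bottleneck x c)%:R).
Proof. by move=> th0; apply: sumr_ge0 => c _; rewrite mulr_ge0. Qed.

Lemma prob_le_bottleneck (th : {ffun vec01 n -> R}) x i :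
  (forall c, 0 <= th c) -> x i ->
  prob th (fun c => c i) <= expect th (fun c => (bottleneck x c)%:R).
Proof.
move=> th0 xi; rewrite /prob big_mkcond; apply: ler_sum => c _.
case: ifP => [ci|_]; last by rewrite mulr_ge0.
rewrite ler_peMr // ler1n /bottleneck.
by apply: leq_trans (leq_bigmax i); rewrite ci xi.
Qed.

Lemma worst_case_le p x : (forall i, 0 <= p i <= 1) ->
  worst_case p x <= Num.min 1 (lin_cost p x).
Proof.
move=> p01; have [th [[th0 th1] thp _] [-> _]] := worst_case_attained x p01.
rewrite le_min; apply/andP; split.
  rewrite -[leRHS]th1; apply: ler_sum => c _.
  by rewrite ler_piMr // lern1 bottleneck_le1.
apply: (@le_trans _ _ (\sum_c th c * (\sum_i c i * x i)%N%:R)).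
  by apply: ler_sum => c _; rewrite ler_wpM2l // ler_nat bottleneck_le_sum.
under eq_bigr do rewrite natr_sum mulr_sumr.
rewrite exchange_big /=; apply: ler_sum => i _.
rewrite -thp /prob mulr_suml [leRHS]big_mkcond; apply: ler_sum => c _.
by rewrite natrM; case: (c i); rewrite ?mul1r // mul0r mulr0.
Qed.

(** Weights of the extremal mixture with marginals [a]: [inl k] sets exactly
    the bit [k], [inr true] draws independent bits of means [a i / m], and
    [inr false] sets no bit. *)
Definition spread_weight (a : 'I_n -> R) m (t : 'I_n + bool) : R :=
  match t with
  | inl k => (1 - m) * a k
  | inr true => m ^+ 2
  | inr false => 1 - m ^+ 2 - (1 - m) * \sum_i a i
  end.

(** Conditional means of the bits in the corresponding components. *)
Definition spread_mean (a : 'I_n -> R) m (t : 'I_n + bool) (i : 'I_n) : R :=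
  match t with
  | inl k => (k == i)%:R
  | inr true => a i / m
  | inr false => 0
  end.

Lemma sum_spread (a : 'I_n -> R) m (F : 'I_n + bool -> R) :
  \sum_t spread_weight a m t * F t =
  (1 - m) * (\sum_k a k * F (inl k)) + m ^+ 2 * F (inr true)
  + (1 - m ^+ 2 - (1 - m) * \sum_i a i) * F (inr false).
Proof.
rewrite big_sumType big_bool /= addrA; congr (_ + _ + _).
by rewrite mulr_sumr; apply: eq_bigr => k _; rewrite mulrA.
Qed.

(** The extremal mixture has pairwise independent bits of means [a]. *)
Section Spread.
Variables (a : 'I_n -> R) (m : R).
Hypotheses (a_ge0 : forall i, 0 <= a i) (a_le : forall i, a i <= m).
Hypotheses (a_sum : \sum_i a i <= 1) (m_gt0 : 0 < m) (m_le1 : m <= 1).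

Lemma spread_weight_ge0 t : 0 <= spread_weight a m t.
Proof.
case: t => [k|[]] /=; [|exact: sqr_ge0|].
  by rewrite mulr_ge0 // subr_ge0.
have := m_gt0; have := m_le1; have := a_sum; nra.
Qed.

Lemma sum_spread_weight : \sum_t spread_weight a m t = 1.
Proof.
transitivity (\sum_t spread_weight a m t * 1).
  by apply: eq_bigr => t _; rewrite mulr1.
by rewrite sum_spread; under eq_bigr do rewrite mulr1; ring.
Qed.

Lemma spread_mean_itv t i : 0 <= spread_mean a m t i <= 1.
Proof.
case: t => [k|[]] /=; rewrite ?lexx ?ler01 //; first by case: eqP => _ /=; lra.
by rewrite divr_ge0 ?(ltW m_gt0) //= ler_pdivrMr // mul1r.
Qed.

Lemma sum_spread_mean i :
  \sum_t spread_weight a m t * spread_mean a m t i = a i.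
Proof.
have m0 : m != 0 by rewrite gt_eqF.
rewrite sum_spread /= (bigD1 i) //= eqxx big1 => [|k /negPf->].
  by rewrite mulr1; field.
by rewrite mulr0.
Qed.

Lemma sum_spread_mean2 i j : i != j ->
  \sum_t spread_weight a m t * (spread_mean a m t i * spread_mean a m t j)
    = a i * a j.
Proof.
have m0 : m != 0 by rewrite gt_eqF.
move=> ij; rewrite sum_spread /= big1 => [|k _]; first by field.
by have [->|_] := eqVneq k i; rewrite ?(negPf ij) ?mul0r !mulr0.
Qed.

End Spread.

Lemma worst_case_ge0 p x : (forall i, 0 <= p i <= 1) -> 0 <= worst_case p x.
Proof.
move=> p01; have [th [[th0 _] _ _] [-> _]] := worst_case_attained x p01.
exact: expect_bottleneck_ge0.
Qed.

(** A vector [a] below [p], supported on the selected elements and of sum at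
    most 1, bounds the worst case from below, the bits [a] being completed to
    marginals [p] by disjunction with independent bits. *)
Lemma worst_case_ge_sum p x (a : 'I_n -> R) : (forall i, 0 <= p i <= 1) ->
  (forall i, 0 <= a i <= p i) -> (forall i, ~~ x i -> a i = 0) ->
  \sum_i a i <= 1 -> 3 / 4 * \sum_i a i <= worst_case p x.
Proof.
move=> p01 ap ax a1.
have a0 i : 0 <= a i by have /andP[] := ap i.
have [a_eq0|] := boolP [forall i, a i == 0].
  rewrite big1 ?mulr0 ?worst_case_ge0 // => i _.
  by apply/eqP; exact: (forallP a_eq0).
rewrite negb_forall => /existsP[i1 ai1].
have [i0 _ amax] := @arg_maxP _ _ _ i1 xpredT a isT.
set m := a i0 in amax.
have m_gt0 : 0 < m by apply: lt_le_trans (amax i1 isT); rewrite lt_def ai1 a0.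
have m_le1 : m <= 1.
  by have /andP[_ h] := ap i0; have /andP[_ h'] := p01 i0; exact: le_trans h h'.
have xsupp k : a k != 0 -> x k by apply: contraNT => /ax ->.
(* When [a i = 1], also [p i = 1], and the default [0^-1 = 0] gives [r i = 0]. *)
pose r i := (p i - a i) / (1 - a i).
have r01 i : 0 <= r i <= 1.
  have /andP[p0 p1] := p01 i; have /andP[_ aip] := ap i.
  have [ai1'|ai1'] := eqVneq (a i) 1.
    by rewrite /r ai1' subrr invr0 mulr0 lexx ler01.
  have d_gt0 : 0 < 1 - a i.
    by rewrite subr_gt0 lt_neqAle ai1' (le_trans aip p1).
  by rewrite /r divr_ge0 ?subr_ge0 ?(le_trans aip) //= ler_pdivrMr //; lra.
have rp i : r i + (1 - r i) * a i = p i.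
  rewrite /r; have [ai1'|ai1'] := eqVneq (a i) 1.
    have /andP[_ p1] := p01 i; have /andP[_ aip] := ap i.
    by rewrite ai1' subrr invr0; lra.
  by field; rewrite subr_eq0 eq_sym.
pose w := spread_weight a m; pose q := spread_mean a m.
pose q' t i := r i + (1 - r i) * q t i.
have q01 t i : 0 <= q t i <= 1.
  by apply: spread_mean_itv => // k; exact: amax.
have q'01 t i : 0 <= q' t i <= 1.
  by rewrite /q'; have /andP[? ?] := q01 t i; have /andP[? ?] := r01 i; nra.
have w0 t : 0 <= w t by exact: spread_weight_ge0.
have th_in : Theta p (mixture w q').
  rewrite (_ : p = fun i => r i + (1 - r i) * a i); last first.
    by apply/funext => i; rewrite rp.
  apply: mixture_or_Theta => //.
  - exact: sum_spread_weight.
  - by move=> i; exact: sum_spread_mean.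
  - by move=> i j; exact: sum_spread_mean2.
have [_ _ [_ /(_ _ th_in)]] := worst_case_attained x p01.
apply: le_trans; rewrite expect_mixture.
pose F t := expect (indep (q' t)) (fun c => (bottleneck x c)%:R).
have F0 t : 0 <= F t.
  by apply: expect_bottleneck_ge0; have [[]] := indep_Theta (q'01 t).
have F1 t i : x i -> q t i = 1 -> 1 <= F t.
  have [[t0 _] tp _] := indep_Theta (q'01 t).
  move=> xi qi; apply: le_trans (prob_le_bottleneck t0 xi).
  by rewrite tp /q' qi mulr1 addrC subrK.
rewrite -/(F _) sum_spread.
have F_true : 1 <= F (inr true).
  apply: (F1 _ i0); last by rewrite /q /= divff // gt_eqF.
  by apply: xsupp; rewrite gt_eqF.
have F_false := F0 (inr false); have w_false := w0 (inr false).
have F_inl : \sum_k a k <= \sum_k a k * F (inl k).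
  apply: ler_sum => k _; have [->|ak] := eqVneq (a k) 0; first by rewrite mul0r.
  by rewrite ler_peMr // (F1 _ k) ?xsupp // /q /= eqxx.
have S0 : 0 <= \sum_i a i by exact: sumr_ge0.
move: (\sum_k a k * _) F_inl => U SU.
apply: (@le_trans _ _ ((1 - m) * \sum_i a i + m ^+ 2)).
  move: (\sum_i a i) a1 S0 => S ? ?.
  (* [(1 - m) * S + m ^+ 2 = (m - S / 2) ^+ 2 + S - S ^+ 2 / 4] *)
  have := sqr_ge0 (m - S / 2); nra.
rewrite -[leLHS]addr0 !lerD //.
- by rewrite ler_wpM2l // subr_ge0.
- by rewrite ler_peMr // sqr_ge0.
- exact: mulr_ge0.
Qed.

Lemma worst_case_ge p x : (forall i, 0 <= p i <= 1) ->
  3 / 4 * Num.min 1 (lin_cost p x) <= worst_case p x.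
Proof.
move=> p01; set S := lin_cost p x.
have px_ge0 i : 0 <= p i * (x i)%:R.
  by rewrite mulr_ge0 //; have /andP[] := p01 i.
have S0 : 0 <= S by exact: sumr_ge0.
have [s [s01 sS]] : exists s : R, 0 <= s <= 1 /\ s * S = Num.min 1 S.
  have [S1|S1] := leP S 1; first by exists 1; rewrite mul1r ler01 lexx.
  have S_gt0 : 0 < S by exact: lt_trans S1.
  exists S^-1; rewrite mulVf ?gt_eqF // invr_ge0 S0 invf_le1 //.
  by split=> //; exact: ltW.
have saE : \sum_i s * (p i * (x i)%:R) = Num.min 1 S by rewrite -mulr_sumr.
rewrite -saE; apply: worst_case_ge_sum => //.
- move=> i; have /andP[s0 s1] := s01; have /andP[p0 p1] := p01 i.
  by case: (x i) => /=; nra.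
- by move=> i /negPf->; rewrite !mulr0.
- by rewrite saE ge_min lexx.
Qed.

(** A feasible solution minimizing [lin_cost p] is 4/3-optimal. *)
Lemma lin_cost_min_approx p (X : {set vec01 n}) x :
  (forall i, 0 <= p i <= 1) -> x \in X ->
  (forall y, y \in X -> lin_cost p x <= lin_cost p y) ->
  opt p X <= worst_case p x <= 4 / 3 * opt p X.
Proof.
move=> p01 xX xmin.
have X0 : X != finset.set0 by apply/set0Pn; exists x.
have [y yX [optE opt_le]] := opt_attained p X0.
rewrite opt_le //= optE.
have x_le := worst_case_le x p01; have y_ge := worst_case_ge y p01.
have xy : Num.min 1 (lin_cost p x) <= Num.min 1 (lin_cost p y).
  by rewrite le_min !ge_min lexx xmin ?orbT.
lra.
Qed.

End Bounds.

(** * The approximation theorem *)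

Theorem proposition2p8 (R : realType) (m : cost_model)
    (I : Type) (descr : I -> seq bool) (n : I -> nat)
    (X : forall i : I, {set vec01 (n i)})
    (X_neq0 : forall i : I, X i != finset.set0)
    (lin_opt : exists (Q : prog) (k : nat), forall (i : I) (c : 'I_(n i) -> R),
      (forall j, admissible m (c j)) ->
      exists x : vec01 (n i),
        [/\ computes_within m Q k
              (DPair (data_bits R (descr i)) (data_vec c)) (data_vec01 R x),
            x \in X i
          & forall y, y \in X i -> lin_cost c x <= lin_cost c y]) :
  exists (P : prog) (k : nat), forall (i : I) (p : 'I_(n i) -> R),
    (forall j, admissible m (p j)) -> (forall j, 0 <= p j <= 1) ->
    exists xhat : vec01 (n i),
      [/\ computes_within m P k
            (DPair (data_bits R (descr i)) (data_vec p)) (data_vec01 R xhat),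
          xhat \in X i
        & opt p (X i) <= worst_case p xhat <= 4 / 3 * opt p (X i)].
Proof.
have [Q [k Qk]] := lin_opt; exists Q, k => i p padm p01.
have [x [runx xX xmin]] := Qk i p padm.
by exists x; split=> //; exact: lin_cost_min_approx.
Qed.
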